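(* For every nonzero-sum mean-payoff game $\mathcal{G}$ with set of vertices $V$, every $\epsilon>0$, every $\delta>0$, every vertex $v\in V$, every strategy $\sigma_0$ of Player 0, and every rational $c$: if $\mathsf{ASV}^{2\delta+\epsilon}_{\mathcal{G}}(\sigma_0)(v)>c$, then for all $\mathcal{H}\in\mathcal{G}^{\pm\delta}$, $$\inf_{\sigma_1\in\mathsf{BR}^{\epsilon}_{1,\mathcal{H}}(\sigma_0)}\underline{\mathsf{MP}}^{\mathcal{H}}_0(\mathsf{Out}_v(\sigma_0,\sigma_1))>c-\delta .$$
   Context: An arena $(V,E,\langle V_0,V_1\rangle,w_0,w_1)$ consists of a finite set $V$ of vertices, a set $E\subseteq V\times V$ of edges such that every vertex has at least one successor, a partition of $V$ into $V_0$ (Player 0) and $V_1$ (Player 1), and weight functions $w_0,w_1:E\to\mathbb{Z}$. A (nonzero-sum) mean-payoff game $\mathcal{G}$ is played on such an arena. A play is an infinite path $\pi=\pi_0\pi_1\dots$; a history is a nonempty finite prefix of a play. The payoff of Player $i\in\{0,1\}$ is $\underline{\mathsf{MP}}_i(\pi)=\liminf_{k\to\infty}\frac1k w_i(\pi_0\dots\pi_k)$, where $w_i$ of a history is the sum of the $w_i$-weights of its edges; a superscript indicates the game whose weights are used. A strategy of Player $i$ maps each history ending in a vertex of $V_i$ to a successor of that last vertex; $\Sigma_i$ is the set of strategies of Player $i$. $\mathsf{Out}_v(\sigma_0,\sigma_1)$ is the unique play from $v$ consistent with $\sigma_0$ and $\sigma_1$. For $\eta>0$ and a game $\mathcal{G}$,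 $\mathsf{BR}^{\eta}_{1,\mathcal{G}}(\sigma_0)$ is the set of $\sigma_1\in\Sigma_1$ such that for all $v\in V$ and all $\sigma_1'\in\Sigma_1$: $\underline{\mathsf{MP}}^{\mathcal{G}}_1(\mathsf{Out}_v(\sigma_0,\sigma_1))>\underline{\mathsf{MP}}^{\mathcal{G}}_1(\mathsf{Out}_v(\sigma_0,\sigma_1'))-\eta$. Further, $\mathsf{ASV}^{\eta}_{\mathcal{G}}(\sigma_0)(v)=\inf_{\sigma_1\in\mathsf{BR}^{\eta}_{1,\mathcal{G}}(\sigma_0)}\underline{\mathsf{MP}}^{\mathcal{G}}_0(\mathsf{Out}_v(\sigma_0,\sigma_1))$. For $\delta>0$, $\mathcal{G}^{\pm\delta}$ is the set of games $\mathcal{H}$ with the same $V,E,V_0,V_1$ as $\mathcal{G}$ and with real weight functions $w_0',w_1'$ satisfying $w_i'(e)\in(w_i(e)-\delta,w_i(e)+\delta)$ for all $e\in E$, $i\in\{0,1\}$. Strategies in $\mathcal{G}$ and $\mathcal{H}$ coincide. *)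

(* Defs.v *)
From HB Require Import structures.
From mathcomp Require Import all_boot all_order all_algebra.
From mathcomp Require Import all_classical all_reals all_analysis.

Set Implicit Arguments.
Unset Strict Implicit.
Unset Printing Implicit Defensive.

Import Order.TTheory GRing.Theory Num.Theory.
Local Open Scope classical_set_scope.
Local Open Scope ring_scope.

Inductive player := P0 | P1.

(* The unweighted part (V, E, V_0, V_1) of an arena. The partition is given by
   the owner of each vertex, so V_i = owner^-1(i); either part may be empty.
   The weights are kept apart since games over perturbed weights share the same
   graph, hence literally the same plays and strategies. *)
Record game_graph (V : finType) := GameGraph {
  edge : rel V;
  owner : V -> player;
  edge_total : forall v, exists u, edge v u
}.

Section Plays.
Context {V : finType} (A : game_graph V).

Definition edges : Type := {e : V * V | edge A e.1 e.2}.

Definition successor (v : V) : Type := {u : V | edge A v u}.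

(* (x, s) stands for the nonempty sequence x :: s. Every finite path is a
   prefix of a play, because every vertex has a successor. *)
Definition history : Type := {h : V * seq V | path (edge A) h.1 h.2}.

Definition hlast (h : history) : V := last (val h).1 (val h).2.

Definition hinit (v : V) : history := exist _ (v, [::]) isT.

Lemma extend_subproof (h : history) (u : successor (hlast h)) :
  path (edge A) (val h).1 (rcons (val h).2 (val u)).
Proof. by rewrite rcons_path (valP h) /=; exact: (valP u). Qed.

Definition extend (h : history) (u : successor (hlast h)) : history :=
  exist _ ((val h).1, rcons (val h).2 (val u)) (extend_subproof u).

Record play := Play {
  play_vertex :> nat -> V;
  play_edge : forall k, edge A (play_vertex k) (play_vertex k.+1)
}.

Definition edge_at (pi : play) (k : nat) : edges :=
  exist _ (pi k, pi k.+1) (play_edge pi k).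

Definition strategy (i : player) : Type :=
  forall h : history, owner A (hlast h) = i -> successor (hlast h).

Definition move (s0 : strategy P0) (s1 : strategy P1) (h : history) :
    successor (hlast h) :=
  match owner A (hlast h) as p
    return owner A (hlast h) = p -> successor (hlast h) with
  | P0 => s0 h
  | P1 => s1 h
  end erefl.

Definition out_history (s0 : strategy P0) (s1 : strategy P1) (v : V)
    (n : nat) : history :=
  iter n (fun h => extend (move s0 s1 h)) (hinit v).

Lemma out_subproof (s0 : strategy P0) (s1 : strategy P1) (v : V) (k : nat) :
  edge A (hlast (out_history s0 s1 v k)) (hlast (out_history s0 s1 v k.+1)).
Proof. by rewrite [in X in edge A _ X]/hlast /= last_rcons; exact: valP. Qed.

Definition Out (v : V) (s0 : strategy P0) (s1 : strategy P1) : play :=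
  Play (out_subproof s0 s1 v).

Definition weighting (T : Type) : Type := player -> edges -> T.

End Plays.

Section Payoffs.
Context {R : realType} {V : finType} {A : game_graph V}.
Implicit Types (w : weighting A R) (i : player) (pi : play A).

Definition real_weights (w : weighting A int) : weighting A R :=
  fun i e => (w i e)%:~R.

(* w_i (pi_0 ... pi_k), a path with k edges. *)
Definition prefix_weight w i pi (k : nat) : R :=
  \sum_(j < k) w i (edge_at pi j).

(* The term at k = 0 is 0 and does not affect the limit inferior. *)
Definition MP w i pi : \bar R :=
  limn_einf (fun k : nat => (k%:R^-1 * prefix_weight w i pi k)%:E).

Definition BR w (eta : R) (s0 : strategy A P0) : set (strategy A P1) :=
  [set s1 | forall (v : V) (s1' : strategy A P1),
     (MP w P1 (Out v s0 s1') - eta%:E < MP w P1 (Out v s0 s1))%E].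

(* The infimum is taken in the extended reals. *)
Definition ASV w (eta : R) (s0 : strategy A P0) (v : V) : \bar R :=
  ereal_inf [set MP w P0 (Out v s0 s1) | s1 in BR w eta s0].

Definition perturbations w (delta : R) : set (weighting A R) :=
  [set w' | forall i (e : edges A),
     w i e - delta < w' i e < w i e + delta].

End Payoffs.

(* Main.v *)
(** Changing every weight by at most [d] changes every mean payoff by at most
    [d]. Hence an [eta]-best response in the perturbed game is a
    [(2 * d + eta)]-best response in the original one, so the infimum for the
    perturbed game is taken over a smaller set, of values that drop by at most
    [d]. *)

Require Import Defs.
From HB Require Import structures.
From mathcomp Require Import all_boot all_order all_algebra.
From mathcomp Require Import all_classical all_reals all_analysis.

Set Implicit Arguments.
Unset Strict Implicit.
Unset Printing Implicit Defensive.

Import Order.TTheory GRing.Theory Num.Theory.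
Local Open Scope classical_set_scope.
Local Open Scope ring_scope.

(** The limit inferior is the limit of the infima of the tails, which always exists, and these
    infima are ordered. *)
Lemma le_limn_einf (R : realType) (u v : (\bar R)^nat) :
  (forall n, (u n <= v n)%E) -> (limn_einf u <= limn_einf v)%E.
Proof.
move=> uv; rewrite !limn_einf_lim.
apply: lee_lim; [exact: is_cvg_einfs | exact: is_cvg_einfs | apply: nearW => n].
apply: le_ereal_inf_tmp => _ [p np <-].
by apply: le_trans (uv p); apply: ereal_inf_lbound; exists p.
Qed.

(** Over [k] edges the two sums differ by at most [k * d], hence the averages by at most [d]; a
    constant shift commutes with the limit inferior. *)
Lemma le_MP_addr (R : realType) (V : finType) (A : game_graph V)
    (w w' : weighting A R) (i : player) (d : R) (pi : play A) :
  0 <= d -> (forall e, w i e <= w' i e + d) ->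
  (MP w i pi <= MP w' i pi + d%:E)%E.
Proof.
move=> d0 ww'; rewrite addeC -limn_einf_shift//.
apply: le_limn_einf => k; rewrite -EFinD lee_fin.
(* At [k = 0] the convention [0^-1 = 0] makes both averages vanish, leaving [0 <= d]. *)
case: k => [|k]; first by rewrite invr0 !mul0r addr0.
have k0 : 0 < k.+1%:R :> R by rewrite ltr0n.
rewrite ler_pdivrMl// mulrDr mulVKf ?gt_eqF// addrC.
have -> : k.+1%:R * d = \sum_(j < k.+1) d by rewrite sumr_const card_ord mulr_natl.
rewrite -big_split /=; exact: ler_sum.
Qed.

(** One [d] is lost on the payoff of the deviation [s1'] and another on that of the response [s1],
    whence [2 * d]. *)
Lemma sub_BR (R : realType) (V : finType) (A : game_graph V)
    (w w' : weighting A R) (d eta : R) (s0 : strategy A P0) :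
  0 <= d -> (forall e, w P1 e <= w' P1 e + d) ->
  (forall e, w' P1 e <= w P1 e + d) ->
  BR w' eta s0 `<=` BR w (2 * d + eta) s0.
Proof.
move=> d0 ww' w'w s1 s1BR v s1'.
have le1 := le_MP_addr (Out v s0 s1') d0 ww'.
have le2 := le_MP_addr (Out v s0 s1) d0 w'w.
have -> : 2 * d + eta = d + eta + d by rewrite mulr_natl mulr2n addrAC.
rewrite EFinD fin_num_oppeD// addeA lteBlDr//; apply: lt_le_trans le2.
apply: le_lt_trans (s1BR v s1').
by rewrite EFinD fin_num_oppeD// addeA leeD2rE// leeBlDr.
Qed.

Theorem theorem6 (R : realType) (V : finType) (A : game_graph V)
    (G : weighting A int) (epsilon delta : R) (v : V)
    (sigma0 : strategy A P0) (c : rat) :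
  0 < epsilon -> 0 < delta ->
  ((ratr c)%:E < ASV (real_weights G) (2 * delta + epsilon) sigma0 v)%E ->
  forall H : weighting A R, perturbations (real_weights G) delta H ->
    ((ratr c - delta)%:E <
       ereal_inf [set MP H P0 (Out v sigma0 sigma1)
                 | sigma1 in BR H epsilon sigma0])%E.
Proof.
move=> _ /ltW d0 cASV H HG.
have GH i e : real_weights G i e <= H i e + delta.
  by have /andP[/ltW] := HG i e; rewrite lerBlDr.
have HG' i e : H i e <= real_weights G i e + delta.
  by have /andP[_ /ltW] := HG i e.
(* An infimum of values above a bound need not exceed it strictly, so the strictness is taken from
   [cASV] and the infima are compared non-strictly. *)
apply: (@lt_le_trans _ _
    (ASV (real_weights G) (2 * delta + epsilon) sigma0 v - delta%:E)%E).
  by rewrite EFinB lteD2rE.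
apply: le_ereal_inf_tmp => _ [s1 s1BR <-].
rewrite leeBlDr//; apply: le_trans (le_MP_addr _ d0 (GH P0)).
apply: ereal_inf_lbound; exists s1 => //.
exact: (sub_BR d0 (GH P1) (HG' P1)).
Qed.
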